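(* Let $f(z)\in\mathbb{R}(z,\log z,\arctan z)$ be analytic in an open set containing the positive reals. Then the sequence $(f(n))_{n\ge1}$ is holonomic if and only if $f(z)$ is a rational function.
   Context: A sequence $(a_n)_{n\ge1}$ of complex numbers is holonomic if there exist polynomials $p_0,\dots,p_d\in\mathbb{C}[x]$, not all zero, such that $p_0(n)a_n+p_1(n)a_{n+1}+\dots+p_d(n)a_{n+d}=0$ for all integers $n\ge1$ (equivalently, for all $n\ge n_0$ for some $n_0$). *)

(* Defs.v *)
From mathcomp Require Import all_boot all_order all_algebra.
From mathcomp Require Import all_classical all_reals all_analysis.
From mathcomp Require Import complex.

Set Implicit Arguments.
Unset Strict Implicit.
Unset Printing Implicit Defensive.

Import Order.TTheory GRing.Theory Num.Theory numFieldNormedType.Exports.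
Import ComplexField.Normc.

Local Open Scope classical_set_scope.
Local Open Scope ring_scope.
Local Open Scope complex_scope.

(* R[i] carries its topology through R[i]^o (the absolute-value topology of a
   numFieldType); derivable on R[i]^o is complex differentiability. *)
Definition analytic_on (R : realType) (U : set R[i]^o)
    (f : R[i]^o -> R[i]^o) : Prop :=
  open U /\ forall z, U z -> derivable f z 1.

Definition positive_reals (R : realType) : set R[i]^o :=
  [set x%:C | x in [set x : R | 0 < x]].
Arguments positive_reals R : clear implicits.

(* Principal argument in ]-pi, pi]; off the cut ]-oo, 0] it is given by the
   half-angle formula tan (Arg z / 2) = Im z / (|z| + Re z). *)
Definition Arg (R : realType) (z : R[i]) : R :=
  if (complex.Im z == 0) && (complex.Re z < 0) then pi
  else 2 * atan (complex.Im z / (normc z + complex.Re z)).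

Definition Log (R : realType) (z : R[i]) : R[i] := ln (normc z) +i* Arg z.

(* Principal branch: arctan z = (Log (1 + iz) - Log (1 - iz)) / (2i). *)
Definition Arctan (R : realType) (z : R[i]) : R[i] :=
  (Log (1 + 'i * z) - Log (1 - 'i * z)) / (2 * 'i).

(* The plane minus the branch cuts ]-oo, 0] of Log and
   {iy : |y| >= 1} of Arctan: a connected open set containing the positive
   reals, on which both functions are analytic. *)
Definition cut_plane (R : realType) : set R[i]^o :=
  [set z : R[i]^o |
    ~ (complex.Im z = 0 /\ complex.Re z <= 0) /\
    ~ (complex.Re z = 0 /\ 1 <= `|complex.Im z|)].

(* P(z, Log z, Arctan z) for P in R[x][y][t] = R[x, y, t]. *)
Definition eval_log_arctan (R : realType) (P : {poly {poly {poly R}}})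
    (z : R[i]) : R[i] :=
  (map_poly (map_poly (map_poly (real_complex R))) P)
    .[(Arctan z)%:P%:P].[(Log z)%:P].[z].

(* f, as a function on U, is an element P/Q of the field R(z, log z, arctan z)
   of meromorphic functions on the cut plane. *)
Definition in_field_log_arctan (R : realType) (U : set R[i]^o)
    (f : R[i]^o -> R[i]^o) : Prop :=
  exists P Q : {poly {poly {poly R}}},
    (exists2 z, cut_plane z & eval_log_arctan Q z != 0) /\
    forall z, U z -> cut_plane z -> eval_log_arctan Q z != 0 ->
      f z = eval_log_arctan P z / eval_log_arctan Q z.

Definition rational_on (R : realType) (U : set R[i]^o)
    (f : R[i]^o -> R[i]^o) : Prop :=
  exists p q : {poly R[i]}, q != 0 /\
    forall z : R[i], U z -> q.[z] != 0 -> f z = p.[z] / q.[z].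

(* A sequence (a_n)_{n >= 1} is given by a : nat -> R[i]; a 0 is irrelevant. *)
Definition holonomic (R : realType) (a : nat -> R[i]) : Prop :=
  exists (d : nat) (p : 'I_d.+1 -> {poly R[i]}),
    (exists k, p k != 0) /\
    forall n : nat, (1 <= n)%N ->
      \sum_(k < d.+1) (p k).[n%:R] * a (n + k)%N = 0.

(* Main.v *)
From HB Require Import structures.
Require Import Defs.
From mathcomp Require Import all_boot all_order all_algebra.
From mathcomp Require Import all_classical all_reals all_analysis.
From mathcomp Require Import complex polyorder ring lra.
From mathcomp Require Import -(notations) mpoly.

Set Implicit Arguments.
Unset Strict Implicit.
Unset Printing Implicit Defensive.

Import Order.TTheory GRing.Theory Num.Theory numFieldNormedType.Exports.
Import ComplexField.Normc.
Local Open Scope classical_set_scope.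
Local Open Scope ring_scope.
Local Open Scope complex_scope.

(* Put v_j = x + j and v'_j = 1 + (x + j)^2, so that log (x + j) and
   arctan (x + j) have derivatives 1 / v_j and 1 / v'_j. These denominators have
   pairwise distinct simple complex roots, whereas the derivative of a rational
   function has no simple pole; hence no nontrivial constant combination of the
   1 / v_j, 1 / v'_j is the derivative of a rational function, and (Ostrowski) a
   nonzero polynomial P in x, log (x + j), arctan (x + j), 0 <= j <= d, does not
   vanish identically. More precisely, dividing P by its leading coefficient a
   (in R[x]) and differentiating lowers the leading monomial, so Rolle's theorem
   shows by induction that P has no zero on some half-line ]N, +oo[.
   A holonomic relation sum_j p_j(n) f(n + j) = 0 is, after clearing
   denominators, the vanishing of such a polynomial at all large n, hence a
   formal identity. There log (x + j) and arctan (x + j) are independent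
   variables for each j; freezing them for all j but one with p_j <> 0 shows that
   P / Q = f is a rational function. Conversely, if f = p / q then
   q(n)^2 f(n) = q(n) p(n) for all n, a recurrence of order one. *)

(** * Polynomials with the derivation of a path *)

(* The derivative of [u / a] has no simple pole. *)
Lemma wronskian_neq_simple_root (F : numFieldType) (W B a u : {poly F}) (z : F) :
    root W z -> W^`().[z] != 0 -> B.[z] != 0 -> a != 0 ->
  W * (a * u^`() - a^`() * u) != a ^+ 2 * B.
Proof.
move=> /factor_theorem[W1 ->]; rewrite derivM derivXsubC mulr1.
rewrite !hornerE subrr mulr0 add0r => W1z Bz.
(* Induction on the size of a: a common factor X - z of a and u comes out squared on both sides and
   cancels. *)
have [k] := ubnP (size a); elim: k a u => // k IH a u sak a0.
have [az0|az] := eqVneq a.[z] 0; last first.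
  apply/eqP => /(congr1 (fun p => p.[z])); rewrite !hornerE subrr.
  rewrite !(mulr0, mul0r) => /esym/eqP.
  by rewrite !mulf_eq0 !(negPf az, negPf Bz).
have [uz0|uz] := eqVneq u.[z] 0.
  have /factor_theorem[a1 a1E] : root a z by apply/eqP.
  have /factor_theorem[u1 u1E] : root u z by apply/eqP.
  have a10 : a1 != 0 by apply: contraNneq a0; rewrite a1E => ->; rewrite mul0r.
  have sa1 : (size a1 < k)%N.
    by move: sak; rewrite a1E size_Mmonic ?monicXsubC// size_XsubC addn2.
  have := IH a1 u1 sa1 a10; apply: contra => /eqP E; apply/eqP.
  have X0 : ('X - z%:P) ^+ 2 != 0 :> {poly F}.
    by rewrite expf_neq0// polyXsubC_eq0.
  apply: (mulfI X0); move: E.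
  rewrite a1E u1E !derivM !derivXsubC !mulr1.
  set X := 'X - z%:P => E.
  transitivity (W1 * X * (a1 * X * (u1^`() * X + u1) - (a1^`() * X + a1) * (u1 * X))).
    ring.
  by rewrite E; ring.
have [s [a1 [a1z aE]]] : exists s (a1 : {poly F}), a1.[z] != 0 /\ a = a1 * ('X - z%:P) ^+ s.+1.
  have [m [q qz aE]] := multiplicity_XsubC a z.
  rewrite a0 /= in qz; case: m aE => [aE|m aE].
    by move: az0 qz; rewrite aE mulr1 => az0; rewrite /root az0 eqxx.
  by exists m, q; split.
apply/eqP => E.
(* Here u(z) != 0, so z is a pole of u / a of order s + 1. After cancelling (X - z)^(s+1), the right
   side vanishes at z, while the left side takes the value -(s + 1) W1(z) a1(z) u(z). *)
have /(congr1 (fun p => p.[z])) :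
    W1 * (a1 * ('X - z%:P) * u^`() - (a1^`() * ('X - z%:P) + a1 *+ s.+1) * u)
      = a1 ^+ 2 * ('X - z%:P) ^+ s.+1 * B.
  have X0 : ('X - z%:P) ^+ s.+1 != 0 :> {poly F}.
    by rewrite expf_neq0// polyXsubC_eq0.
  apply: (mulfI X0); move: E; rewrite aE derivM deriv_exp derivXsubC mul1r /=.
  set X := 'X - z%:P => E.
  transitivity (W1 * X * (a1 * X ^+ s.+1 * u^`() - (a1^`() * X ^+ s.+1 + a1 * (X ^+ s *+ s.+1)) * u)).
    rewrite -[X ^+ s *+ _]mulr_natr -[a1 *+ _]mulr_natr [X ^+ s.+1]exprS.
    by move: (X ^+ s) (s.+1%:R : {poly F}) => Xs t; ring.
  by rewrite E; move: (X ^+ s.+1) => Y; ring.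
rewrite !hornerE subrr !(mulr0, mul0r, expr0n, sub0r, add0r) /= ?mulr0 ?mul0r.
rewrite hornerMn => /eqP; rewrite mulrN oppr_eq0 !mulf_eq0 mulrn_eq0 /=.
by rewrite (negPf W1z) (negPf a1z) (negPf uz).
Qed.

Lemma lead_coef_deriv (F : realFieldType) (p : {poly F}) :
  lead_coef p^`() = lead_coef p *+ (size p).-1.
Proof.
rewrite !lead_coefE polyorder.size_deriv coef_deriv.
case sp: (size p) => [|[|k]] //=;
  by rewrite nth_default ?sp// mul0rn mulr0n.
Qed.

(** The quotient c / a has zero derivative. The constant k removes the term of degree deg a from e =
    c - k a, whereas leading coefficients in a e' = a' e force deg e = deg a unless e = 0. *)
Lemma wronskian0_scale (F : realFieldType) (a c : {poly F}) :
  a != 0 -> a * c^`() = a^`() * c -> exists k, c = k *: a.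
Proof.
move=> a0 E.
pose k := c`_(size a).-1 / lead_coef a.
exists k; apply/eqP; rewrite -subr_eq0; set e := c - k *: a.
have ea : e`_(size a).-1 = 0.
  by rewrite coefB coefZ /k -lead_coefE divfK ?subrr// lead_coef_eq0.
have Ee : a * e^`() = a^`() * e.
  by rewrite /e derivB derivZ !mulrBr E -!scalerAr [a * _]mulrC.
have [//|e0] := eqVneq e 0.
have /eqP := congr1 lead_coef Ee; rewrite !lead_coefM !lead_coef_deriv.
rewrite mulrnAl mulrnAr -[X in X == _]mulr_natr -[X in _ == X]mulr_natr.
rewrite (inj_eq (mulfI _)) ?mulf_neq0 ?lead_coef_eq0// eqr_nat => /eqP ss.
by move: ea; rewrite -ss -lead_coefE => /eqP; rewrite lead_coef_eq0 (negPf e0).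
Qed.

(** * Lowering the leading monomial by differentiation *)

Section FormalDerivation.
Variables (R : rcfType) (n : nat) (v : 'I_n -> {poly R}).
Implicit Types (P Q : mpoly n {poly R}) (m : multinom n).

Definition den := \prod_j v j.
(** This is [den / v i]: multiplying the derivation by [den] keeps all coefficients polynomial. *)
Definition codiv i := \prod_(j | j != i) v j.

Definition deriv_coefs P : mpoly n {poly R} :=
  \sum_(m <- msupp P) (mcoeff m P)^`() *: mpolyX _ m.

Lemma mcoeff_deriv_coefs P m : mcoeff m (deriv_coefs P) = (mcoeff m P)^`().
Proof.
rewrite /deriv_coefs raddf_sum /=.
under eq_bigr do rewrite mcoeffZ mcoeffX.
have [mP|mP] := boolP (m \in msupp P); last first.
  rewrite [mcoeff m P]memN_msupp_eq0// deriv0 big_seq big1// => k kP.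
  by case: eqP => [km|]; [rewrite -km kP in mP | rewrite mulr0].
rewrite (bigD1_seq m) ?msupp_uniq//= eqxx mulr1 big1 ?addr0// => k km.
by rewrite (negPf km) mulr0.
Qed.

Lemma deriv_coefsM P Q : deriv_coefs (P * Q) = deriv_coefs P * Q + P * deriv_coefs Q.
Proof.
apply/mpolyP => m; rewrite mcoeffD mcoeff_deriv_coefs !mcoeffM raddf_sum /=.
by rewrite -big_split /=; apply: eq_bigr => k _; rewrite derivM !mcoeff_deriv_coefs.
Qed.

(* [den * d/dx], where the [i]-th variable has derivative [1 / v i]. *)
Definition path_deriv P : mpoly n {poly R} :=
  den *: deriv_coefs P + \sum_i codiv i *: mderiv i P.

Lemma path_derivD P Q : path_deriv (P + Q) = path_deriv P + path_deriv Q.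
Proof.
rewrite /path_deriv addrACA -scalerDr -big_split /=; congr (_ *: _ + _).
  by apply/mpolyP => m; rewrite mcoeffD !mcoeff_deriv_coefs mcoeffD derivD.
by apply: eq_bigr => i _; rewrite mderivD scalerDr.
Qed.

Lemma path_derivM P Q :
  path_deriv (P * Q) = path_deriv P * Q + P * path_deriv Q.
Proof.
rewrite /path_deriv deriv_coefsM mulrDl mulrDr addrACA scalerDr.
rewrite -scalerAl -scalerAr; congr (_ + _).
rewrite mulr_suml mulr_sumr -big_split /=; apply: eq_bigr => i _.
by rewrite mderivM scalerDr -scalerAl -scalerAr.
Qed.

Lemma path_derivC c : path_deriv (mpolyC n c) = mpolyC n (den * c^`()).
Proof.
rewrite /path_deriv big1 ?addr0 => [|i _]; last by rewrite mderivC scaler0.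
apply/mpolyP => m; rewrite mcoeffZ mcoeff_deriv_coefs !mcoeffC.
by case: eqP; rewrite ?mulr1 ?mulr0// deriv0 mulr0.
Qed.

Lemma path_derivX i : path_deriv (mpolyX _ (mnm1 i)) = mpolyC n (codiv i).
Proof.
have X'0 : deriv_coefs (mpolyX _ (mnm1 i)) = 0.
  apply/mpolyP => m; rewrite mcoeff_deriv_coefs mcoeffX mcoeff0.
  by case: eqP => _ /=; [rewrite mulr1n -polyC1 derivC | rewrite mulr0n deriv0].
rewrite /path_deriv X'0 scaler0 add0r.
rewrite (bigD1 i) //= big1 ?addr0 => [|j ji]; rewrite mderivX mnm1E.
  have -> : mnm_sub (mnm1 i) (mnm1 i) = mnm0.
    by apply/mnmP => k; rewrite mnmBE subnn mnm0E.
  by rewrite eqxx scale1r mpolyX0 -mul_mpolyC mulr1.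
by rewrite eq_sym (negPf ji) scale0r scaler0.
Qed.

(* [mleadc P ^+ 2] times [path_deriv] of [P / mleadc P]. *)
Definition lead_deriv P : mpoly n {poly R} :=
  mleadc P *: path_deriv P - (den * (mleadc P)^`()) *: P.

(** The first term is a Wronskian from differentiating the coefficient at m; the second comes from
    the successors of m, which lose one variable when it is differentiated. *)
Lemma mcoeff_lead_deriv P m : mcoeff m (lead_deriv P) =
  den * (mleadc P * (mcoeff m P)^`() - (mleadc P)^`() * mcoeff m P)
  + mleadc P * \sum_i codiv i * (mcoeff (mnm_add m (mnm1 i)) P *+ (m i).+1).
Proof.
rewrite /lead_deriv mcoeffB !mcoeffZ mcoeffD mcoeffZ mcoeff_deriv_coefs.
rewrite raddf_sum /=; under eq_bigr do rewrite mcoeffZ mcoeff_deriv.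
by rewrite mulrDr mulrBr !mulrA [mleadc P * den]mulrC addrAC.
Qed.

Lemma ltm_addU m i : (m < mnm_add m (mnm1 i))%O.
Proof. by rewrite lt_mdeg_ltmc// mdegD mdeg1 addn1. Qed.

(** At the leading monomial the Wronskian is that of [mleadc P] with itself; every other coefficient
    involved lies beyond the leading monomial. *)
Lemma mcoeff_lead_deriv_ge P m : (mlead P <= m)%O -> mcoeff m (lead_deriv P) = 0.
Proof.
move=> Pm; rewrite mcoeff_lead_deriv [X in _ + _ * X]big1 => [|i _]; last first.
  rewrite mcoeff_gt_mlead ?mul0rn ?mulr0//.
  exact: le_lt_trans Pm (ltm_addU _ _).
rewrite mulr0 addr0; move: Pm; rewrite le_eqVlt => /predU1P[<-|Pm].
  by rewrite [_^`() * _]mulrC subrr mulr0.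
by rewrite [mcoeff m P]mcoeff_gt_mlead// deriv0 !mulr0 subrr mulr0.
Qed.

Lemma mlead_lead_deriv P : lead_deriv P != 0 -> (mlead (lead_deriv P) < mlead P)%O.
Proof.
rewrite ltNge => DP0; apply/negP => /mcoeff_lead_deriv_ge/eqP.
by rewrite mleadc_eq0 (negPf DP0).
Qed.

(** The roots are taken in [R[i]] because 1 + (x + j)^2 has none in [R]. *)
Variable z : 'I_n -> R[i].
Local Notation toC := (map_poly (real_complex R)).
Hypothesis root_z : forall i, root (toC (v i)) (z i).
Hypothesis simple_z : forall i, (toC (v i)^`()).[z i] != 0.
Hypothesis disjoint_z : forall i j, i != j -> (toC (v j)).[z i] != 0.

Lemma den_neq0 : den != 0.
Proof.
apply/prodf_neq0 => i _; apply: contraNneq (simple_z i) => ->.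
by rewrite deriv0 rmorph0 horner0.
Qed.

(** Divided by [den * a ^+ 2], this says that sum_j g_j / v_j is not the derivative of u / a: it has
    a simple pole at [z i]. *)
Lemma codiv_not_derivative (g : 'I_n -> R) i (a u : {poly R}) :
    g i != 0 -> a != 0 ->
  den * (a * u^`() - a^`() * u) != a ^+ 2 * \sum_j g j *: codiv j.
Proof.
move=> gi a0; apply/eqP => /(congr1 toC)/eqP; apply/negP.
rewrite !(rmorphM, rmorphB, rmorphXn) /= -!deriv_map.
have codivE j : (toC (codiv j)).[z i] = \prod_(k | k != j) (toC (v k)).[z i].
  by rewrite rmorph_prod horner_prod.
have codivi : (toC (codiv i)).[z i] != 0.
  by rewrite codivE; apply/prodf_neq0 => k ki; apply: disjoint_z; rewrite eq_sym.
apply: (@wronskian_neq_simple_root _ _ _ _ _ (z i)).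
- by rewrite rmorph_prod; apply/rootP; rewrite horner_prod (bigD1 i)//= (rootP (root_z i)) mul0r.
- rewrite /den (bigD1 i) //= rmorphM derivM hornerD !hornerM (rootP (root_z i)) mul0r addr0.
  by rewrite deriv_map mulf_neq0.
- rewrite raddf_sum /= horner_sum (bigD1 i) //= big1 => [|j ji].
    by rewrite addr0 map_polyZ hornerZ mulf_neq0// eq_complex /= negb_and gi.
  rewrite map_polyZ hornerZ codivE (bigD1 i) 1?eq_sym//= (rootP (root_z i)).
  by rewrite mul0r mulr0.
- by rewrite map_poly_eq0.
Qed.

(** Let a be the leading coefficient and m the leading monomial divided by a variable X_i. If
    [lead_deriv P] were zero, its coefficients at m X_j would make those of P constant multiples g_j
    a, with g_i != 0. At m, where P has coefficient u, this would give (u / a)' = - sum_j g_j (m_j +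
    1) / v_j, contrary to [codiv_not_derivative]. *)
Lemma lead_deriv_neq0 P : mlead P != mnm0 -> lead_deriv P != 0.
Proof.
move=> lP; have [i Pi] : exists i, mlead P i != 0%N.
  apply/existsP; rewrite -negb_forall; apply: contra lP => /forallP h.
  by apply/eqP/mnmP => i; rewrite mnm0E; apply/eqP.
have P0 : P != 0 by apply: contraNneq lP => ->; rewrite mlead0.
have a0 : mleadc P != 0 by rewrite mleadc_eq0.
pose m := mnm_sub (mlead P) (mnm1 i).
have mE : mnm_add m (mnm1 i) = mlead P.
  by rewrite submK// lep1mP.
apply/eqP => DP0.
have /boolp.choice[g gE] : forall j, exists k,
    mcoeff (mnm_add m (mnm1 j)) P = k *: mleadc P.
  move=> j; apply: wronskian0_scale a0 _; apply/eqP; rewrite -subr_eq0.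
  have := congr1 (mcoeff (mnm_add m (mnm1 j))) DP0.
  (* The monomial order is graded and m X_j has the total degree of the leading monomial, so its
     successors do not occur in P. *)
  rewrite mcoeff0 mcoeff_lead_deriv [X in _ + _ * X]big1 => [|l _]; last first.
    rewrite mcoeff_gt_mlead ?mul0rn ?mulr0//.
    by rewrite -mE lt_mdeg_ltmc// !mdegD !mdeg1 !addn1.
  by rewrite mulr0 addr0 => /eqP; rewrite mulf_eq0 (negPf den_neq0).
have gi : g i != 0.
  by apply: contraNneq a0 => gi; have := gE i; rewrite mE gi scale0r => ->.
pose h j := - (g j * (m j).+1%:R).
have hE : \sum_j codiv j * (mcoeff (mnm_add m (mnm1 j)) P *+ (m j).+1)
    = - (mleadc P * \sum_j h j *: codiv j).
  rewrite mulr_sumr -sumrN; apply: eq_bigr => j _.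
  rewrite gE /h scaleNr mulrN opprK -!mul_polyC polyCM polyC_natr.
  rewrite -[(g j)%:P * _ *+ _]mulr_natr.
  by move: (_.+1%:R : {poly R}) => k; ring.
have := congr1 (mcoeff m) DP0; rewrite mcoeff0 mcoeff_lead_deriv hE mulrN mulrA.
move/eqP; rewrite subr_eq0 -expr2; apply/negP.
apply: (@codiv_not_derivative _ i) a0.
by rewrite oppr_eq0 mulf_neq0// pnatr_eq0.
Qed.

(** Well-founded induction on the leading monomial: [lead_deriv] lowers it and yields a nonzero
    polynomial until only an element of R[x] is left. *)
Lemma mpoly_lead_deriv_ind (T : mpoly n {poly R} -> Prop) :
    (forall a, a != 0 -> T (mpolyC n a)) ->
    (forall P, mleadc P != 0 -> T (lead_deriv P) -> T P) ->
  forall P, P != 0 -> T P.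
Proof.
move=> T0 TD P; move eP : (mlead P) => m.
elim/(@ltmwf n): m P eP => m IH P eP P0.
have [l0|l0] := eqVneq (mlead P) mnm0.
  have -> : P = mpolyC n (mleadc P).
    apply/mpolyP => k; rewrite mcoeffC l0; have [->|k0] := eqVneq k mnm0.
      by rewrite mulr1.
    rewrite mulr0 mcoeff_gt_mlead// l0 lt_mdeg_ltmc// mdeg0 lt0n.
    by rewrite mdeg_eq0.
  by apply: T0; rewrite mleadc_eq0.
have DP0 := lead_deriv_neq0 l0.
apply: TD; first by rewrite mleadc_eq0.
by apply: (IH (mlead (lead_deriv P))); rewrite // -eP mlead_lead_deriv.
Qed.
End FormalDerivation.

(** * Derivatives of Log and Arctan along real curves *)

Section PolarDerivatives.
Variables (R : realType) (u v : R -> R) (t du dv : R).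
Hypotheses (hu : is_derive t 1 u du) (hv : is_derive t 1 v dv).
Let r s := Num.sqrt (u s ^+ 2 + v s ^+ 2).
Hypothesis offcut : ~ (v t = 0 /\ u t <= 0).

Lemma sqr_polar_gt0 : 0 < u t ^+ 2 + v t ^+ 2.
Proof.
rewrite lt_neqAle addr_ge0 ?sqr_ge0// andbT eq_sym paddr_eq0 ?sqr_ge0//.
rewrite !sqrf_eq0; apply/andP => -[/eqP u0 /eqP v0]; apply: offcut.
by rewrite u0 v0.
Qed.

(** This is the denominator of the half-angle formula. If u <= 0, being off the cut gives v != 0,
    hence r^2 > u^2. *)
Lemma polar_add_gt0 : 0 < r t + u t.
Proof.
have r0 : 0 < r t by rewrite sqrtr_gt0 sqr_polar_gt0.
have rE : r t ^+ 2 = u t ^+ 2 + v t ^+ 2 by rewrite sqr_sqrtr// ltW// sqr_polar_gt0.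
have [u0|u0] := ltP 0 (u t); first exact: addr_gt0.
have v0 : v t != 0 by apply/eqP => v0; exact: offcut.
have : 0 < v t ^+ 2 by rewrite lt_neqAle sqr_ge0 eq_sym sqrf_eq0 v0.
by move: rE r0 u0; move: (r t) => q; nra.
Qed.

Lemma is_derive_radius : is_derive t 1 r ((u t * du + v t * dv) / r t).
Proof.
have r0 : 0 < r t by rewrite sqrtr_gt0 sqr_polar_gt0.
have hq : is_derive t 1 (u * u + v * v) (2 * (u t * du + v t * dv)).
  apply: is_derive_eq (is_deriveD (is_deriveM hu hu) (is_deriveM hv hv)) _.
  by rewrite /GRing.scale /=; ring.
have hs : is_derive ((u * u + v * v) t) 1 (@Num.sqrt R) (2 * r t)^-1.
  have -> : r t = Num.sqrt ((u * u + v * v) t) by rewrite /r !expr2.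
  by apply: is_derive1_sqrt; rewrite /= -!expr2; exact: sqr_polar_gt0.
suff : is_derive t 1 (@Num.sqrt R \o (u * u + v * v)) ((u t * du + v t * dv) / r t) by [].
by apply: is_derive_eq (is_derive1_comp hs hq) _; field; rewrite gt_eqF.
Qed.

Lemma is_derive_ln_radius : is_derive t 1 (fun s => ln (r s))
  ((u t * du + v t * dv) / (u t ^+ 2 + v t ^+ 2)).
Proof.
have r0 : 0 < r t by rewrite sqrtr_gt0 sqr_polar_gt0.
have rE : r t ^+ 2 = u t ^+ 2 + v t ^+ 2 by rewrite sqr_sqrtr// ltW// sqr_polar_gt0.
apply: is_derive_eq (is_derive1_comp (is_derive1_ln r0) is_derive_radius) _.
by rewrite -rE; field; rewrite gt_eqF.
Qed.

Lemma is_derive_half_angle : is_derive t 1 (fun s => 2 * atan (v s / (r s + u s)))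
  ((u t * dv - v t * du) / (u t ^+ 2 + v t ^+ 2)).
Proof.
have r0 : 0 < r t by rewrite sqrtr_gt0 sqr_polar_gt0.
have rE : r t ^+ 2 = u t ^+ 2 + v t ^+ 2 by rewrite sqr_sqrtr// ltW// sqr_polar_gt0.
have ru0 := polar_add_gt0.
have hV := @is_deriveV _ (r + u) t _ 1 (lt0r_neq0 ru0) (is_deriveD is_derive_radius hu).
have hq := is_deriveM hv hV.
have ha := is_derive1_comp (is_derive1_atan _) hq.
apply: is_derive_eq (is_deriveZ 2 ha) _.
rewrite /GRing.scale /= -rE.
have vE : v t ^+ 2 = r t ^+ 2 - u t ^+ 2 by rewrite rE; ring.
have -> : ((v * (fun y => ((r + u) y)^-1)) t) = v t / (r t + u t) by [].
have -> : ((r + u) t) = r t + u t by [].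
(* From v^2 = r^2 - u^2 one gets (r + u)^2 + v^2 = 2 r (r + u). *)
have -> : (1 + (v t / (r t + u t)) ^+ 2)^-1 = (r t + u t) / (2 * r t).
  rewrite expr_div_n vE; field.
  rewrite !gt_eqF//=.
  by rewrite (_ : _ + _ = 2 * r t * (r t + u t)) ?mulr_gt0//; ring.
move: vE ru0 r0; move: (r t) (u t) (v t) => a b c.
move=> vE ru0 r0.
transitivity (dv / a - c * du / a ^+ 2 - c ^+ 2 * dv / (a ^+ 2 * (a + b))).
  by field; rewrite !gt_eqF.
by rewrite vE; field; rewrite !gt_eqF.
Qed.
End PolarDerivatives.

(** Differentiation along a real parameter, by components, reduces [Log] and [Arctan] to the real
    functions [ln] and [atan]. *)
Definition has_cderiv (R : realType) (g : R -> R[i]) (t : R) (l : R[i]) :=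
  is_derive t 1 (fun s => complex.Re (g s)) (complex.Re l) /\
  is_derive t 1 (fun s => complex.Im (g s)) (complex.Im l).

Section ComplexDerivatives.
Variable R : realType.
Implicit Types (g h : R -> R[i]) (t : R) (a b c : R[i]).

Lemma has_cderiv_eq g t a b : has_cderiv g t a -> a = b -> has_cderiv g t b.
Proof. by move=> ? <-. Qed.

Lemma has_cderiv_cst c t : has_cderiv (fun=> c) t 0.
Proof. by split; exact: is_derive_cst. Qed.

Lemma complex_ReD (x y : R[i]) : complex.Re (x + y) = complex.Re x + complex.Re y.
Proof. by case: x y => [? ?] [? ?]. Qed.

Lemma complex_ImD (x y : R[i]) : complex.Im (x + y) = complex.Im x + complex.Im y.
Proof. by case: x y => [? ?] [? ?]. Qed.

Lemma has_cderivD g h t a b : has_cderiv g t a -> has_cderiv h t b ->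
  has_cderiv (fun s => g s + h s) t (a + b).
Proof.
move=> [gr gi] [hr hi]; split.
  by under eq_fun do rewrite complex_ReD; rewrite complex_ReD; exact: is_deriveD.
by under eq_fun do rewrite complex_ImD; rewrite complex_ImD; exact: is_deriveD.
Qed.

Lemma complex_ReM (x y : R[i]) :
  complex.Re (x * y) = complex.Re x * complex.Re y - complex.Im x * complex.Im y.
Proof. by case: x y => [? ?] [? ?]. Qed.

Lemma complex_ImM (x y : R[i]) :
  complex.Im (x * y) = complex.Re x * complex.Im y + complex.Im x * complex.Re y.
Proof. by case: x y => [? ?] [? ?]. Qed.

Lemma has_cderivM g h t a b : has_cderiv g t a -> has_cderiv h t b ->
  has_cderiv (fun s => g s * h s) t (a * h t + g t * b).
Proof.
move=> [gr gi] [hr hi]; split.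
  under eq_fun do rewrite complex_ReM.
  apply: is_derive_eq (is_deriveB (is_deriveM gr hr) (is_deriveM gi hi)) _.
  by rewrite /GRing.scale /= complex_ReD !complex_ReM; ring.
under eq_fun do rewrite complex_ImM.
apply: is_derive_eq (is_deriveD (is_deriveM gr hi) (is_deriveM gi hr)) _.
by rewrite /GRing.scale /= complex_ImD !complex_ImM; ring.
Qed.

Lemma has_cderiv_horner (p : {poly R[i]}) g t a : has_cderiv g t a ->
  has_cderiv (fun s => p.[g s]) t (p^`().[g t] * a).
Proof.
move=> ga; elim/poly_ind: p => [|p c IH].
  under eq_fun do rewrite horner0.
  by rewrite deriv0 horner0 mul0r; exact: has_cderiv_cst.
under eq_fun do rewrite hornerMXaddC.
apply: has_cderiv_eq (has_cderivD (has_cderivM IH ga) (has_cderiv_cst c t)) _.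
by rewrite derivD derivC derivM derivX mulr1 !addr0 hornerD hornerMX; ring.
Qed.

Lemma complex_Re_div (x y : R[i]) : complex.Re (x / y) =
  (complex.Re y * complex.Re x + complex.Im y * complex.Im x)
    / (complex.Re y ^+ 2 + complex.Im y ^+ 2).
Proof. by rewrite complex_ReM; case: x y => [? ?] [? ?] /=; ring. Qed.

Lemma complex_Im_div (x y : R[i]) : complex.Im (x / y) =
  (complex.Re y * complex.Im x - complex.Im y * complex.Re x)
    / (complex.Re y ^+ 2 + complex.Im y ^+ 2).
Proof. by rewrite complex_ImM; case: x y => [? ?] [? ?] /=; ring. Qed.

Lemma has_cderiv_Log g t a : has_cderiv g t a ->
  ~ (complex.Im (g t) = 0 /\ complex.Re (g t) <= 0) ->
  has_cderiv (fun s => Log (g s)) t (a / g t).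
Proof.
move=> [gr gi] offcut.
have normcE s : normc (g s) = Num.sqrt (complex.Re (g s) ^+ 2 + complex.Im (g s) ^+ 2).
  by case: (g s).
split.
  rewrite complex_Re_div; under eq_fun do rewrite /= normcE.
  exact: is_derive_ln_radius.
rewrite complex_Im_div; apply: near_eq_is_derive (is_derive_half_angle gr gi offcut).
(* By continuity |g| + Re g stays positive near t, which excludes the first case of [Arg]; there
   [Arg] is the half-angle formula. *)
have ru0 := @polar_add_gt0 _ (fun s => complex.Re (g s)) (fun s => complex.Im (g s)) t offcut.
have := is_deriveD (is_derive_radius gr gi offcut) gr.
move=> /@ex_derive/derivable1_diffP/differentiable_continuous/cvgr_gt.
move=> /(_ _ ru0); apply: filterS => s rus.
have {}rus : 0 < Num.sqrt (complex.Re (g s) ^+ 2 + complex.Im (g s) ^+ 2)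
    + complex.Re (g s) by exact: rus.
rewrite /Log /= /Arg normcE ifF//; apply/negP => /andP[/eqP y0 x0]; move: rus.
by rewrite y0 expr0n addr0 sqrtr_sqr ltr0_norm// addNr ltxx.
Qed.

Lemma i_sqr : ('i : R[i]) * 'i = -1.
Proof. by rewrite -expr2 sqr_i. Qed.

Lemma has_cderiv_Arctan g t a : has_cderiv g t a ->
  ~ (complex.Re (g t) = 0 /\ 1 <= `|complex.Im (g t)|) ->
  has_cderiv (fun s => Arctan (g s)) t (a / (1 + g t ^+ 2)).
Proof.
move=> ga offcut.
have hi (e : R[i]) : has_cderiv (fun s => 1 + e * g s) t (e * a).
  apply: has_cderiv_eq (has_cderivD (has_cderiv_cst 1 t)
    (has_cderivM (has_cderiv_cst e t) ga)) _.
  by rewrite mul0r !add0r.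
(* The two cuts of [Arctan] are the preimages of the cut of [Log] under z -> 1 + iz and z -> 1 -
   iz. *)
have off1 : ~ (complex.Im (1 + 'i * g t) = 0 /\ complex.Re (1 + 'i * g t) <= 0).
  move: offcut; case: (g t) => x y /= offcut [x0 y1]; apply: offcut; split; first lra.
  by rewrite ger0_norm; lra.
have off2 : ~ (complex.Im (1 + - 'i * g t) = 0 /\ complex.Re (1 + - 'i * g t) <= 0).
  move: offcut; case: (g t) => x y /= offcut [x0 y1]; apply: offcut; split; first lra.
  by rewrite ler0_norm; lra.
have zi0 (z : R[i]) : ~ (complex.Im z = 0 /\ complex.Re z <= 0) -> z != 0.
  by move=> zoff; apply/eqP => z0; apply: zoff; rewrite z0.
(* The imaginary unit becomes an indeterminate j for [field]; j * j = -1 serves to factor 1 +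
   z^2. *)
have key (j z : R[i]) : j * j = -1 -> j != 0 -> 1 + j * z != 0 -> 1 + - j * z != 0 ->
    (j * a / (1 + j * z) + (0 * Log (1 + - j * z) + -1 * (- j * a / (1 + - j * z)))) / (2 * j)
      + (Log (1 + j * z) + -1 * Log (1 + - j * z)) * 0 = a / (1 + z ^+ 2).
  move=> jj j0 n1 n2.
  have -> : 1 + z ^+ 2 = (1 + j * z) * (1 + - j * z).
    by transitivity (1 - j * j * z ^+ 2); [rewrite jj; ring | ring].
  by move: (Log _) (Log _) => l1 l2; field; rewrite j0 n1 n2.
have {}hi := has_cderivM (has_cderivD (has_cderiv_Log (hi 'i) off1)
  (has_cderivM (has_cderiv_cst (-1) t) (has_cderiv_Log (hi (- 'i)) off2)))
  (has_cderiv_cst (2 * 'i)^-1 t).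
have -> : (fun s => Arctan (g s)) = (fun s =>
    (Log (1 + 'i * g s) + -1 * Log (1 + - 'i * g s)) / (2 * 'i)).
  by apply/funext => s; rewrite /Arctan mulN1r mulNr.
apply: has_cderiv_eq hi _.
have i0 : ('i : R[i]) != 0 by rewrite eq_complex /= negb_and oner_eq0 orbT.
exact: key i_sqr i0 (zi0 _ off1) (zi0 _ off2).
Qed.

End ComplexDerivatives.

(** * Evaluation of polynomials along a curve *)

Section Evaluation.
Variables (R : realType) (n : nat).
Local Notation toC := (map_poly (real_complex R)).
Implicit Types (P : mpoly n {poly R}) (z : R[i]) (y : 'I_n -> R[i]).

Definition ev z y : mpoly n {poly R} -> R[i] :=
  mmap (horner_eval z \o toC) y.

HB.instance Definition _ z y := GRing.RMorphism.on (ev z y).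

Lemma evC z y c : ev z y (mpolyC n c) = (toC c).[z].
Proof. exact: mmapC. Qed.

Lemma evX z y j : ev z y (mpolyX _ (mnm1 j)) = y j.
Proof. by rewrite /ev mmapX mmap1U. Qed.

Lemma evZ z y c P : ev z y (c *: P) = (toC c).[z] * ev z y P.
Proof. exact: mmapZ. Qed.

Lemma ev_real z y P : z \is Num.real -> (forall j, y j \is Num.real) ->
  ev z y P \is Num.real.
Proof.
move=> /complex_realP[x ->] yr; rewrite /ev /mmap; apply: rpred_sum => m _.
rewrite rpredM//; last by apply: rpred_prod => j _; rewrite rpredX.
by rewrite /= /horner_eval horner_map complex_real.
Qed.

Variable v : 'I_n -> {poly R}.

Lemma ev_lead_deriv z y P : ev z y (lead_deriv v P) =
  (toC (mleadc P)).[z] * ev z y (path_deriv v P)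
  - (toC (den v)).[z] * (toC (mleadc P)^`()).[z] * ev z y P.
Proof. by rewrite /lead_deriv rmorphB /= !evZ rmorphM hornerM. Qed.

(** Chain rule. Both sides satisfy the sum and product rules, so coefficients and single variables
    suffice. *)
Lemma has_cderiv_ev (g : R -> R[i]) (h : 'I_n -> R -> R[i]) t P :
    has_cderiv g t 1 -> (forall j, (toC (v j)).[g t] != 0) ->
    (forall j, has_cderiv (h j) t (toC (v j)).[g t]^-1) ->
  has_cderiv (fun s => ev (g s) (h^~ s) P) t
    (ev (g t) (h^~ t) (path_deriv v P) / (toC (den v)).[g t]).
Proof.
move=> dg v0 dh.
have den0 : (toC (den v)).[g t] != 0.
  rewrite rmorph_prod horner_prod; apply/prodf_neq0 => i _; exact: v0.
pose D P := has_cderiv (fun s => ev (g s) (h^~ s) P) t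
    (ev (g t) (h^~ t) (path_deriv v P) / (toC (den v)).[g t]).
have DC c : D (mpolyC n c).
  rewrite /D; under eq_fun do rewrite evC.
  apply: has_cderiv_eq (has_cderiv_horner (toC c) dg) _.
  by rewrite path_derivC evC rmorphM /= hornerM deriv_map mulrAC divff ?mul1r ?mulr1.
have DX j : D (mpolyX _ (mnm1 j)).
  rewrite /D; under eq_fun do rewrite evX.
  apply: has_cderiv_eq (dh j) _; rewrite path_derivX evC.
  rewrite /den (bigD1 j)//= rmorphM hornerM -/(codiv v j).
  have : (toC (codiv v j)).[g t] != 0.
    rewrite rmorph_prod horner_prod; apply/prodf_neq0 => i _; exact: v0.
  by move=> c0; rewrite mulrC invfM -mulrA mulVf ?mulr1.
have DD Q1 Q2 : D Q1 -> D Q2 -> D (Q1 + Q2).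
  move=> D1 D2; rewrite /D; under eq_fun do rewrite rmorphD /=.
  apply: has_cderiv_eq (has_cderivD D1 D2) _.
  by rewrite path_derivD [ev _ _ (_ + path_deriv _ _)]rmorphD mulrDl.
have DM Q1 Q2 : D Q1 -> D Q2 -> D (Q1 * Q2).
  move=> D1 D2; rewrite /D; under eq_fun do rewrite rmorphM /=.
  apply: has_cderiv_eq (has_cderivM D1 D2) _.
  rewrite path_derivM [ev _ _ (_ * _ + _)]rmorphD /=.
  by rewrite ![ev _ _ (_ * _)]rmorphM /=; ring.
elim/mpolyind: P => [|c m P _ _ DP]; first by have := DC 0; rewrite mpolyC0.
apply: DD DP; rewrite -mul_mpolyC; apply: (DM) => //.
rewrite mpolyXE_id; apply: (big_ind D) => [|Q1 Q2|j _]; [by rewrite -mpolyC1 | exact: DM |].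
elim: (m j) => [|k IH]; first by rewrite expr0 -mpolyC1.
by rewrite exprS; exact: DM.
Qed.

End Evaluation.

(** * The shifts of the logarithm and the arctangent *)

Section ShiftedLogArctan.
Variables (R : realType) (d : nat).
Local Notation toC := (map_poly (real_complex R)).
Local Notation n := (d.+1 + d.+1)%N.

(** The first [d.+1] variables stand for log (x + k), the last [d.+1] for arctan (x + k); their
    derivatives are the inverses of these polynomials. *)
Definition shift_den (j : 'I_n) : {poly R} :=
  match fintype.split j with
  | inl k => 'X + k%:R%:P
  | inr k => 1 + ('X + k%:R%:P) ^+ 2
  end.

Definition shift_root (j : 'I_n) : R[i] :=
  match fintype.split j with
  | inl k => - k%:R
  | inr k => (- k%:R) +i* 1
  end.

Definition shift_fun (z : R[i]) (j : 'I_n) : R[i] :=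
  match fintype.split j with
  | inl k => Log (z + k%:R)
  | inr k => Arctan (z + k%:R)
  end.

Lemma shift_denE j z : (toC (shift_den j)).[z] =
  match fintype.split j with
  | inl k => z + k%:R
  | inr k => 1 + (z + k%:R) ^+ 2
  end.
Proof.
rewrite /shift_den; case: fintype.split => k.
  by rewrite rmorphD /= map_polyX map_polyC /= rmorph_nat !hornerE.
by rewrite rmorphD rmorph1 rmorphXn rmorphD /= map_polyX map_polyC /= rmorph_nat !hornerE.
Qed.

Lemma natrC (k : nat) : k%:R = (k%:R : R)%:C :> R[i].
Proof. by rewrite rmorph_nat. Qed.

Lemma shift_root_root j : root (toC (shift_den j)) (shift_root j).
Proof.
rewrite /root shift_denE /shift_root; case: fintype.split => k; first by rewrite addNr.
by rewrite natrC eq_complex /=; apply/andP; split; apply/eqP; ring.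
Qed.

Lemma shift_root_simple j : (toC (shift_den j)^`()).[shift_root j] != 0.
Proof.
rewrite /shift_den /shift_root; case: fintype.split => k.
  by rewrite derivD derivX derivC addr0 rmorph1 hornerC oner_neq0.
rewrite derivD derivC add0r deriv_exp derivD derivX derivC addr0 mul1r expr1.
rewrite rmorphMn rmorphD /= map_polyX map_polyC hornerMn !hornerE.
rewrite mulrn_eq0 /= eq_complex /= negb_and [_ + 0]addr0 oner_neq0 orbT//.
Qed.

Lemma shift_root_disjoint i j : i != j -> (toC (shift_den j)).[shift_root i] != 0.
Proof.
move=> ij; rewrite shift_denE /shift_root.
have ne (k l : 'I_d.+1) : (k : nat) != l -> (- k%:R + l%:R : R) != 0.
  by move=> kl; rewrite addrC subr_eq0 eqr_nat eq_sym.
have [k iE|k iE] := fintype.splitP i; have [l jE|l jE] := fintype.splitP j.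
- rewrite !natrC -rmorphN -rmorphD fmorph_eq0 ne//.
  by apply: contraNneq ij => kl; apply/eqP/val_inj; rewrite /= iE jE kl.
- rewrite !natrC -rmorphN -rmorphD -rmorphXn -(rmorph1 (real_complex R)) -rmorphD.
  by rewrite fmorph_eq0 gt_eqF// ltr_pwDl// sqr_ge0.
- by rewrite natrC eq_complex /= negb_and addr0 oner_neq0 orbT.
(* The value 1 + (l - k + i)^2 has imaginary part 2 (l - k). *)
- rewrite natrC eq_complex negb_and; apply/orP; right; rewrite /= !addr0 !mul1r.
  rewrite mulr1 -mulr2n add0r mulrn_eq0 /= ne//.
  by apply: contraNneq ij => kl; apply/eqP/val_inj; rewrite /= iE jE kl.
Qed.

Lemma cut_plane_neq0 (z : R[i]) : cut_plane z -> z != 0.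
Proof. by move=> [z0 _]; apply/eqP => zE; apply: z0; rewrite zE. Qed.

Lemma cut_plane_sqr_neq0 (z : R[i]) : cut_plane z -> 1 + z ^+ 2 != 0.
Proof.
move=> [_ cut]; apply/eqP => z2; apply: cut; move: z2; case: z => x y.
move=> /eqP; rewrite eq_complex /= => /andP[/eqP re /eqP im].
have [x0|x0] := eqVneq x 0.
  split=> //; rewrite -[1]sqrtr1 -sqrtr_sqr ler_wsqrtr//.
  by move: re; rewrite x0; nra.
have y0 : y = 0.
  apply/eqP; move: im => /eqP; rewrite add0r [y * x]mulrC -mulr2n mulrn_eq0 /= mulf_eq0.
  by rewrite (negPf x0).
by move: re; rewrite y0; nra.
Qed.

(** Height y = 0 gives the real axis, with [horizontal 0 s] convertible to [s%:C]; heights y != 0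
    serve to reach points near an arbitrary point of the plane. *)
Definition horizontal (y s : R) : R[i] := s +i* y.

Lemma has_cderiv_horizontal y t : has_cderiv (horizontal y) t 1.
Proof. by split => /=; [exact: is_derive_id | exact: is_derive_cst]. Qed.

Lemma has_cderiv_horizontalD y c t : has_cderiv (fun s => horizontal y s + c) t 1.
Proof.
apply: has_cderiv_eq (has_cderivD (has_cderiv_horizontal y t) (has_cderiv_cst c t)) _.
by rewrite addr0.
Qed.

Lemma shift_den_neq0 j z :
  (forall k : 'I_d.+1, cut_plane (z + k%:R)) -> (toC (shift_den j)).[z] != 0.
Proof.
move=> zk; rewrite shift_denE; case: fintype.split => k.
  exact: cut_plane_neq0.
exact: cut_plane_sqr_neq0.
Qed.

Lemma has_cderiv_shift_ev y t (P : mpoly n {poly R}) :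
    (forall k : 'I_d.+1, cut_plane (horizontal y t + k%:R)) ->
  has_cderiv (fun s => ev (horizontal y s) (shift_fun (horizontal y s)) P) t
    (ev (horizontal y t) (shift_fun (horizontal y t)) (path_deriv shift_den P)
      / (toC (den shift_den)).[horizontal y t]).
Proof.
move=> zk; apply: (@has_cderiv_ev _ _ _ _ (fun j s => shift_fun (horizontal y s) j)).
- exact: has_cderiv_horizontal.
- by move=> j; exact: shift_den_neq0.
move=> j; rewrite shift_denE /shift_fun.
case: fintype.split => k; have [c1 c2] := zk k.
  apply: has_cderiv_eq (has_cderiv_Log (has_cderiv_horizontalD y k%:R t) c1) _.
  by rewrite mul1r.
apply: has_cderiv_eq (has_cderiv_Arctan (has_cderiv_horizontalD y k%:R t) c2) _.
by rewrite mul1r.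
Qed.

End ShiftedLogArctan.

Lemma has_cderiv_near0 (R : realType) (g : R -> R[i]) t l :
  (\forall s \near t, g s = 0) -> has_cderiv g t l -> l = 0.
Proof.
move=> g0 [gr gi]; apply/eqP; rewrite eq_complex; apply/andP; split; apply/eqP.
  have h : is_derive t 1 (fun=> 0 : R) (complex.Re l).
    by apply: near_eq_is_derive gr; apply: filterS g0 => s ->.
  by rewrite -(@derive_val _ _ _ _ _ _ _ h) derive_cst.
have h : is_derive t 1 (fun=> 0 : R) (complex.Im l).
  by apply: near_eq_is_derive gi; apply: filterS g0 => s ->.
by rewrite -(@derive_val _ _ _ _ _ _ _ h) derive_cst.
Qed.

Lemma poly_neq0_horizontal (R : realType) (p : {poly R[i]}) (y a b : R) :
  p != 0 -> a < b -> exists2 s, a < s < b & p.[horizontal y s] != 0.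
Proof.
move=> p0 ab; apply: contrapT => no.
(* Distinct points of ]a, b[; starting at the denominator 2 keeps them below b. Taking [size p] of
   them exceeds the number of roots. *)
pose x i := a + (b - a) / i.+2%:R.
have xab i : a < x i < b.
  rewrite ltrDl divr_gt0 ?subr_gt0 ?ltr0n//= -ltrBrDl.
  by rewrite ltr_pdivrMr ?ltr0n// ltr_pMr ?subr_gt0// ltr1n.
have := @max_poly_roots _ p [seq horizontal y (x i) | i <- iota 0 (size p)] p0.
rewrite size_map size_iota ltnn => h.
suff : false by []; apply: h.
  apply/allP => _ /mapP[i _ ->]; apply: contrapT => /negP pi0.
  by apply: no; exists (x i).
rewrite map_inj_uniq ?iota_uniq// => i j [] /addrI /(mulfI _).
rewrite subr_eq0 gt_eqF// => /(_ isT)/invr_inj/eqP.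
by rewrite eqr_nat => /eqP[].
Qed.

Section RealValues.
Variable R : realType.

Lemma cut_plane_pos (x : R) : 0 < x -> cut_plane (x%:C : R[i]).
Proof. by move=> x0; split=> /= -[]; lra. Qed.

Lemma Log_real (x : R) : 0 < x -> Log x%:C \is Num.real.
Proof.
move=> x0; rewrite complex_real /Arg /= eqxx ltNge ltW//=.
by rewrite mul0r atan0 mulr0.
Qed.

(** The conjugates 1 + ix and 1 - ix have equal modulus, so the difference of their logarithms is
    purely imaginary. *)
Lemma Arctan_real (x : R) : Arctan x%:C \is Num.real.
Proof.
have Im0_real (z : R[i]) : complex.Im z = 0 -> z \is Num.real.
  by case: z => a b /= ->; rewrite complex_real.
apply: Im0_real; rewrite /Arctan complex_Im_div.
have -> : complex.Re (2 * 'i : R[i]) = 0 by rewrite /=; ring.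
rewrite mul0r sub0r; apply/eqP; rewrite mulf_eq0 oppr_eq0 mulf_eq0; apply/orP; left.
apply/orP; right; rewrite /= subr_eq0; apply/eqP; congr (ln (Num.sqrt _)).
ring.
Qed.

End RealValues.

(** * Algebraic independence of the shifted functions *)

Section Nonvanishing.
Variables (R : realType) (d : nat).
Local Notation toC := (map_poly (real_complex R)).
Local Notation n := (d.+1 + d.+1)%N.
Implicit Types P : mpoly n {poly R}.

Let shift_ind := mpoly_lead_deriv_ind (@shift_root_root R d)
  (@shift_root_simple R d) (@shift_root_disjoint R d).

(** If P vanished along the whole segment, so would its derivative, and with it [lead_deriv P],
    contrary to the induction hypothesis. *)
Lemma ev_shift_neq0_segment P y a b : P != 0 -> a < b ->
    (forall s, a < s < b ->
      forall k : 'I_d.+1, cut_plane (horizontal y s + k%:R)) ->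
  exists2 s, a < s < b & ev (horizontal y s) (shift_fun (horizontal y s)) P != 0.
Proof.
move=> P0 ab cut; move: P P0; apply: shift_ind => [c c0|P l0 [s sab]].
  have tc0 : toC c != 0 by rewrite map_poly_eq0.
  by have [s sab cs] := poly_neq0_horizontal y tc0 ab; exists s; rewrite ?evC.
apply: contraPP => no.
have ev0 s' : a < s' < b -> ev (horizontal y s') (shift_fun (horizontal y s')) P = 0.
  by move=> s'ab; have [//|z0] := eqVneq (ev (horizontal y s') (shift_fun (horizontal y s')) P) 0; case: no; exists s'.
have : ev (horizontal y s) (shift_fun (horizontal y s)) (path_deriv (@shift_den R d) P)
    / (toC (den (@shift_den R d))).[horizontal y s] = 0.
  apply: has_cderiv_near0 (has_cderiv_shift_ev P (cut s sab)).
  have : s \in `]a, b[ by rewrite in_itv.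
  move=> /near_in_itvoo; apply: filterS => s'; rewrite in_itv; exact: ev0.
move=> /eqP; rewrite mulf_eq0 invr_eq0 [X in _ || X]negbTE; last first.
  rewrite rmorph_prod horner_prod; apply/prodf_neq0 => j _.
  by apply: shift_den_neq0; exact: cut.
rewrite orbF => /eqP D0.
by rewrite ev_lead_deriv D0 ev0// !mulr0 subrr => /eqP.
Qed.

Lemma ev_shift_real (x : R) P : 0 < x ->
  ev x%:C (shift_fun x%:C) P \is Num.real.
Proof.
move=> x0; apply: ev_real => [|j]; first by rewrite complex_real.
rewrite /shift_fun; case: fintype.split => k; rewrite natrC -rmorphD.
  by apply: Log_real; rewrite ltr_wpDr.
exact: Arctan_real.
Qed.

(** With a the leading coefficient, [lead_deriv P] is den a^2 times the derivative of P / a. By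
    induction it has no zero far out, so Rolle's theorem leaves P at most one zero there, and N is
    moved past it. *)
Lemma ev_shift_neq0_infty P : P != 0 ->
  exists N : R, forall x, N < x -> ev x%:C (shift_fun x%:C) P != 0.
Proof.
move: P; apply: shift_ind => [c c0|P l0 [N1 DP]].
  exists (polyrcf.cauchy_bound c) => x Nx.
  rewrite evC horner_map fmorph_eq0.
  by apply: (polyrcf.ge_cauchy_bound c0); rewrite in_itv /= andbT ltW.
pose a := mleadc P.
(* Beyond N the points are positive, hence off the cuts, the induction hypothesis applies, and a has
   no root. *)
pose N := Num.max 0 (Num.max N1 (polyrcf.cauchy_bound a)).
have Nprop (x : R) : N < x -> [/\ 0 < x, N1 < x & a.[x] != 0].
  rewrite !gt_max => /and3P[x0 x1 x2]; split=> //.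
  by apply: (polyrcf.ge_cauchy_bound l0); rewrite in_itv /= andbT ltW.
suff inj (x1 x2 : R) : N < x1 -> x1 < x2 -> ev x1%:C (shift_fun x1%:C) P = 0 ->
    ev x2%:C (shift_fun x2%:C) P = 0 -> False.
  have [[x1 Nx1 z1]|no] := pselect (exists2 x, N < x & ev x%:C (shift_fun x%:C) P = 0).
    exists x1 => x2 x12; apply/eqP => z2; exact: inj x12 z1 z2.
  by exists N => x Nx; apply/eqP => z; apply: no; exists x.
move=> Nx1 x12 z1 z2.
pose e (s : R) := ev s%:C (@shift_fun R d s%:C).
pose w s := e s (path_deriv (@shift_den R d) P) / (toC (den (@shift_den R d))).[s%:C].
have cut (s : R) : 0 < s -> forall k : 'I_d.+1, cut_plane (horizontal 0 s + k%:R).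
  move=> s0 k; rewrite natrC -[horizontal 0 s]/(s%:C) -rmorphD.
  by apply: cut_plane_pos; rewrite ltr_wpDr.
have du (s : R) : N < s -> is_derive s 1 (fun s => complex.Re (e s P)) (complex.Re (w s)).
  by move=> /Nprop[s0 _ _]; have [] := has_cderiv_shift_ev P (cut s s0).
have da (s : R) : is_derive s 1 (fun s => a.[s]) a^`().[s].
  have [h _] := has_cderiv_horner (toC a) (has_cderiv_horizontal 0 s).
  have -> : (fun s => a.[s]) = (fun s => complex.Re (toC a).[horizontal 0 s]).
    by apply/funext => s'; rewrite -[horizontal 0 s']/(s'%:C) horner_map.
  apply: is_derive_eq h _.
  by rewrite mulr1 deriv_map -[horizontal 0 s]/(s%:C) horner_map.
have dq (s : R) : N < s -> is_derive s 1 (fun s => complex.Re (e s P) / a.[s])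
    (complex.Re (e s P) * (- a.[s] ^- 2 * a^`().[s]) + a.[s]^-1 * complex.Re (w s)).
  move=> Ns; have [_ _ as0] := Nprop s Ns.
  exact: is_deriveM (du s Ns) (is_deriveV as0 (da s)).
have [c|||c] := @Rolle R (fun s => complex.Re (e s P) / a.[s]) x1 x2 x12.
- rewrite in_itv /= => /andP[x1c _]; apply: (@ex_derive _ _ _ _ _ _ _ (dq c _)).
  exact: lt_trans Nx1 x1c.
- apply: derivable_within_continuous => c; rewrite in_itv /= => /andP[x1c _].
  apply: (@ex_derive _ _ _ _ _ _ _ (dq c _)); exact: lt_le_trans Nx1 x1c.
- by rewrite /e z1 z2 !mul0r.
rewrite in_itv /= => /andP[x1c _] dc0.
have Nc := lt_trans Nx1 x1c; have [c0 N1c ac] := Nprop c Nc.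
have := @derive_val _ _ _ _ _ _ _ dc0.
rewrite (@derive_val _ _ _ _ _ _ _ (dq c Nc)) => eq0.
have den0 : (toC (den (@shift_den R d))).[c%:C] != 0.
  rewrite rmorph_prod horner_prod; apply/prodf_neq0 => j _.
  by apply: shift_den_neq0; exact: cut.
(* All values at positive reals are real, so the real part used in Rolle's theorem loses nothing. *)
have wr : w c = (complex.Re (w c))%:C.
  apply/esym/RRe_real; rewrite /w horner_map rpredM ?ev_shift_real//.
  by rewrite rpredV complex_real.
have eE : e c (path_deriv (@shift_den R d) P)
    = (toC (den (@shift_den R d))).[c%:C] * (complex.Re (w c))%:C.
  by rewrite -wr /w mulrC divfK.
have pE : e c P = (complex.Re (e c P))%:C by rewrite RRe_real// ev_shift_real.
have := DP c N1c; rewrite ev_lead_deriv -/(e c _) eE -/(e c P) pE !horner_map.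
rewrite -/a mulrCA -mulrA -mulrBr -!rmorphM -rmorphB mulf_eq0 negb_or.
rewrite fmorph_eq0 => /andP[_]; rewrite fmorph_eq0 => /eqP; apply.
(* Multiplying the vanishing derivative of P / a at c by a(c)^2 gives the remaining factor of
   [lead_deriv P]. *)
have : a.[c] ^+ 2 * 0 = a.[c] ^+ 2 * 0 :> R by [].
rewrite -{1}eq0 mulr0; move: ac; move: (complex.Re (w c)) (complex.Re (e c P)).
move: a.[c] a^`().[c] => p p' wc ec p0 <-; field.
exact: p0.
Qed.

End Nonvanishing.

(** * Holonomic relations *)

Section TernaryEvaluation.
Variable R : realType.
Local Notation toC := (map_poly (real_complex R)).
Implicit Types (P : {poly {poly {poly R}}}) (z l t : R[i]).

(** Coefficients are evaluated first, which composes ring morphisms; with [eval3], the arguments z,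
    l, t become independent. *)
Definition eval2 z l : {poly {poly R}} -> R[i] :=
  horner_eval l \o map_poly (horner_eval z \o toC).

HB.instance Definition _ z l := GRing.RMorphism.on (eval2 z l).

Definition eval3 z l t : {poly {poly {poly R}}} -> R[i] :=
  horner_eval t \o map_poly (eval2 z l).

HB.instance Definition _ z l t := GRing.RMorphism.on (eval3 z l t).

(** Freezing the last two variables leaves a polynomial in z, from which [separate_variables] builds
    its coefficients. *)
Definition slice l t P : {poly R[i]} :=
  (map_poly (map_poly toC) P).[t%:P%:P].[l%:P].

Lemma horner_hornerC (A : comNzRingType) (X : {poly {poly A}}) (x a : A) :
  X.[x%:P].[a] = (map_poly (horner_eval a) X).[x].
Proof. by rewrite -[LHS]/(horner_eval a _) -horner_map /= /horner_eval hornerC. Qed.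

Lemma horner_slice z l t P : (slice l t P).[z] = eval3 z l t P.
Proof.
have E2 (q : {poly {poly R}}) : (map_poly toC q).[l%:P].[z] = eval2 z l q.
  have E1 : map_poly (horner_eval z) (map_poly toC q)
      = map_poly (horner_eval z \o toC) q.
    by apply/polyP => i; rewrite !coef_map.
  by rewrite horner_hornerC E1.
have E3 : map_poly (horner_eval z) (map_poly (horner_eval l%:P)
    (map_poly (map_poly toC) P)) = map_poly (eval2 z l) P.
  by apply/polyP => i; rewrite !coef_map; exact: E2.
by rewrite /slice [X in X.[z]]horner_hornerC horner_hornerC E3.
Qed.

Lemma eval_log_arctanE P z :
  eval_log_arctan P z = eval3 z (Log z) (Arctan z) P.
Proof. exact: horner_slice. Qed.

Variable d : nat.
Local Notation n := (d.+1 + d.+1)%N.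

(** With [embed3], this is the formal shift by k: x becomes x + k and the outer variables become
    those standing for log (x + k) and arctan (x + k). *)
Definition embed2 (k : 'I_d.+1) : {poly {poly R}} -> mpoly n {poly R} :=
  horner_eval (mpolyX _ (mnm1 (lshift d.+1 k)))
    \o map_poly (@mpolyC n {poly R} \o comp_poly ('X + k%:R%:P)).

HB.instance Definition _ k := GRing.RMorphism.on (embed2 k).

Definition embed3 (k : 'I_d.+1) : {poly {poly {poly R}}} -> mpoly n {poly R} :=
  horner_eval (mpolyX _ (mnm1 (rshift d.+1 k))) \o map_poly (embed2 k).

Lemma ev_embed3 k z (y : 'I_n -> R[i]) P :
  ev z y (embed3 k P) = eval3 (z + k%:R) (y (lshift _ k)) (y (rshift _ k)) P.
Proof.
rewrite /embed3 /= /horner_eval -horner_map /= evX /eval3 /= /horner_eval.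
congr (_.[_]); apply/polyP => i; rewrite !coef_map /=; move: P`_i => q.
rewrite /embed2 /= /horner_eval -horner_map /= evX /eval2 /= /horner_eval.
congr (_.[_]); apply/polyP => j; rewrite !coef_map /=.
rewrite evC map_comp_poly horner_comp /horner_eval rmorphD /= map_polyX map_polyC /=.
rewrite rmorph_nat !hornerE.
exact: (esym (coef_map (horner_eval (z + k%:R) \o toC) q j)).
Qed.

Lemma ev_embed3_shift k z P :
  ev z (shift_fun z) (embed3 k P) = eval_log_arctan P (z + k%:R).
Proof.
rewrite ev_embed3 eval_log_arctanE /shift_fun.
by rewrite -[lshift _ k]/(unsplit (inl k)) -[rshift _ k]/(unsplit (inr k)) !unsplitK.
Qed.

End TernaryEvaluation.

(** With A = q^2 and B = q p, A(n) f(n) = B(n) holds even where q(n) = 0, both sides being zero. The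
    recurrence is A(n) B(n+1) f(n) = A(n+1) B(n) f(n+1). *)
Lemma holonomic_of_rational (R : realType) (U : set R[i]^o) (f : R[i]^o -> R[i]^o) :
  (forall n : nat, (1 <= n)%N -> U n%:R) -> rational_on U f ->
  holonomic (fun n : nat => f n%:R).
Proof.
move=> Un [p [q [q0 fE]]].
have qqf (m : nat) : (1 <= m)%N -> (q ^+ 2).[m%:R] * f m%:R = (q * p).[m%:R].
  move=> m1; rewrite horner_exp hornerM; have [->|qm] := eqVneq q.[m%:R] 0.
    by rewrite expr0n !mul0r.
  by rewrite fE //; [field | exact: Un].
(* For p = 0 that recurrence is trivial; q^2 f = 0, of order zero, replaces it. *)
have [p0|p0] := eqVneq p 0.
  exists 0%N, (fun=> q ^+ 2); split; first by exists ord0; rewrite expf_neq0.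
  by move=> m m1; rewrite big_ord1 addn0 qqf// p0 mulr0 horner0.
have : q * p != 0 by rewrite mulf_neq0.
have : q ^+ 2 != 0 by rewrite expf_neq0.
move: (q ^+ 2) (q * p) qqf => A B ABf A0 B0.
pose S := 'X + 1%:P : {poly R[i]}.
exists 1%N, (fun k => if k == ord0 then A * (B \Po S) else - (A \Po S) * B); split.
  exists ord0; rewrite eqxx mulf_neq0//.
  by rewrite comp_poly2_eq0 // size_XaddC.
move=> m m1; rewrite big_ord_recl big_ord1 /= addn0 addn1.
rewrite !(hornerM, hornerN, horner_comp, hornerD, hornerX, hornerC) natr1.
have := ABf m m1; have := ABf m.+1 isT.
move: (f _) (f _) => f1 f0 <- <-; ring.
Qed.

(** The real part of a multiple of the relation is taken; the multiplier c makes [p k1] monic, so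
    that its real part is nonzero. *)
Lemma real_relation (R : realType) (d : nat) (p : 'I_d.+1 -> {poly R[i]}) k1 :
  p k1 != 0 -> exists2 q : 'I_d.+1 -> {poly R}, q k1 != 0 &
    forall (x : R) (g : 'I_d.+1 -> R),
      \sum_k (p k).[x%:C] * (g k)%:C = 0 -> \sum_k (q k).[x] * g k = 0.
Proof.
move=> p0; pose c := (lead_coef (p k1))^-1.
pose re (r : {poly R[i]}) : {poly R} := \poly_(i < size r) complex.Re (c * r`_i).
have reE r (x : R) : (re r).[x] = complex.Re (c * r.[x%:C]).
  rewrite horner_poly horner_coef mulr_sumr (big_morph _ (@complex_ReD R) (erefl _)).
  apply: eq_bigr => i _; rewrite mulrA [RHS]complex_ReM.
  by rewrite -rmorphXn /= mulr0 subr0.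
exists (re \o p) => [/=|x g pg].
  apply/eqP => /(congr1 (fun r : {poly R} => r`_(size (p k1)).-1)).
  rewrite coef0 coef_poly prednK ?size_poly_gt0// leqnn -lead_coefE /c.
  by rewrite mulVf ?lead_coef_eq0//= => /eqP; rewrite oner_eq0.
transitivity (complex.Re (c * \sum_k (p k).[x%:C] * (g k)%:C)); last first.
  by rewrite pg mulr0.
rewrite mulr_sumr (big_morph _ (@complex_ReD R) (erefl _)); apply: eq_bigr => k _ /=.
by rewrite reE mulrA [RHS]complex_ReM /= mulr0 subr0.
Qed.

(* The variables of index [j != k0] are frozen at a point [(l0, t0)] where [Q]
   is a nonzero polynomial in [z]. *)
Lemma separate_variables (R : realType) (d : nat) (P Q : {poly {poly {poly R}}})
    (q : 'I_d.+1 -> {poly R}) k0 (z0 l0 t0 : R[i]) :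
    q k0 != 0 -> eval3 z0 l0 t0 Q != 0 ->
    \sum_k mpolyC _ (q k) * (embed3 k P * \prod_(j | j != k) embed3 j Q) = 0 ->
  exists a b : {poly R[i]}, a != 0 /\
    forall z l t, a.[z] * eval3 z l t P = b.[z] * eval3 z l t Q.
Proof.
move=> qk0 Q0 sum0.
(* The identity is evaluated at z - k0, so that block k0 receives z and block k receives z + k -
   k0. *)
pose S (k : 'I_d.+1) : {poly R[i]} := 'X + (k%:R - k0%:R)%:P.
pose qS k := map_poly (real_complex R) (q k) \Po ('X + (- k0%:R)%:P).
pose PS k := slice l0 t0 P \Po S k.
pose QS k := slice l0 t0 Q \Po S k.
(* Each term with k != k0 contains the unfrozen factor Q of block k0; M is the sum of their
   cofactors. *)
pose M := \sum_(k | k != k0) qS k * (PS k * \prod_(j | (j != k) && (j != k0)) QS j).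
exists (qS k0 * \prod_(j | j != k0) QS j), (- M); split.
  rewrite mulf_neq0 ?comp_poly2_eq0 ?size_XaddC ?map_poly_eq0//.
  apply/prodf_neq0 => j _; rewrite comp_poly2_eq0 ?size_XaddC//.
  by apply: contraNneq Q0 => Q0; rewrite -horner_slice Q0 horner0.
move=> z l t.
pose y (j : 'I_(d.+1 + d.+1)) := match fintype.split j with
  | inl k => if k == k0 then l else l0
  | inr k => if k == k0 then t else t0 end.
have evy k (X : {poly {poly {poly R}}}) : ev (z - k0%:R) y (embed3 k X) =
    if k == k0 then eval3 z l t X else (slice l0 t0 X \Po S k).[z].
  rewrite ev_embed3 /y -[lshift _ k]/(unsplit (inl k)) -[rshift _ k]/(unsplit (inr k)).
  rewrite !unsplitK; case: eqP => [->|_]; first by rewrite subrK.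
  by rewrite horner_comp horner_slice hornerD hornerX hornerC -addrA [- _ + _]addrC.
have evq k : ev (z - k0%:R) y (mpolyC _ (q k)) = (qS k).[z].
  by rewrite evC horner_comp hornerD hornerX hornerC.
have ev0 : ev (z - k0%:R) y (mpolyC _ (q k0) *
      (embed3 k0 P * \prod_(j | j != k0) embed3 j Q))
    = (qS k0 * \prod_(j | j != k0) QS j).[z] * eval3 z l t P.
  rewrite !rmorphM rmorph_prod /= evq evy eqxx hornerM horner_prod -mulrA.
  congr (_ * _); rewrite mulrC; congr (_ * _).
  by apply: eq_bigr => j /negPf jk0; rewrite evy jk0.
have ev1 k : k != k0 -> ev (z - k0%:R) y (mpolyC _ (q k) *
      (embed3 k P * \prod_(j | j != k) embed3 j Q))
    = (qS k * (PS k * \prod_(j | (j != k) && (j != k0)) QS j)).[z] * eval3 z l t Q.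
  move=> kk0; rewrite !rmorphM rmorph_prod /= evq evy (negPf kk0) !hornerM horner_prod.
  rewrite -!mulrA; congr (_ * (_ * _)); rewrite (bigD1 k0) 1?eq_sym//= evy eqxx mulrC.
  by congr (_ * _); apply: eq_bigr => j /andP[_ /negPf jk0]; rewrite evy jk0.
have := congr1 (ev (z - k0%:R) y) sum0; rewrite rmorph0 rmorph_sum (bigD1 k0) //=.
rewrite ev0 (eq_bigr _ ev1) -mulr_suml -horner_sum => /eqP.
by rewrite addr_eq0 -mulNr -hornerN => /eqP.
Qed.

(** Cleared of denominators, the relation is a polynomial in the shifted functions that vanishes at
    all large integers. It is therefore zero, and its variables can be separated. *)
Lemma rational_of_holonomic_relation (R : realType) (d : nat)
    (P Q : {poly {poly {poly R}}}) (p : 'I_d.+1 -> {poly R[i]}) k1 (z0 : R[i])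
    (f : R[i] -> R[i]) :
    p k1 != 0 -> eval_log_arctan Q z0 != 0 ->
    (forall x : R, 0 < x -> eval_log_arctan Q x%:C != 0 ->
      f x%:C = eval_log_arctan P x%:C / eval_log_arctan Q x%:C) ->
    (forall n : nat, (1 <= n)%N ->
      \sum_(k < d.+1) (p k).[n%:R] * f (n + k)%:R = 0) ->
  exists a b : {poly R[i]}, a != 0 /\
    forall z, a.[z] * eval_log_arctan P z = b.[z] * eval_log_arctan Q z.
Proof.
move=> pk1 Q0 fE prel.
have [q qk1 qrel] := real_relation pk1.
have embQ0 : embed3 (ord0 : 'I_d.+1) Q != 0.
  by apply: contraNneq Q0 => eQ; rewrite -[z0]addr0 -(ev_embed3_shift (ord0 : 'I_d.+1)) eQ rmorph0.
have [N1 QN1] := ev_shift_neq0_infty embQ0.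
have {}QN1 x : N1 < x -> eval_log_arctan Q x%:C != 0.
  by move=> /QN1; rewrite ev_embed3_shift addr0.
suff sum0 : \sum_(k < d.+1) mpolyC _ (q k) *
    (embed3 k P * \prod_(j | j != k) embed3 j Q) = 0.
  have := separate_variables qk1 _ sum0.
  move=> /(_ z0 (Log z0) (Arctan z0)); rewrite -eval_log_arctanE => /(_ Q0).
  by move=> [a [b [a0 ab]]]; exists a, b; split => // z; rewrite !eval_log_arctanE.
apply: contrapT => /eqP/ev_shift_neq0_infty[N2 GN2].
(* Beyond N1 all Q(m + k) are nonzero, so f(m + k) is P / Q; beyond N2 the polynomial, if nonzero,
   would have no zero. *)
pose m := (Num.trunc (Num.max N1 N2)).+1.
have : (m%:R : R) > Num.max N1 N2 by exact: truncnS_gt.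
rewrite gt_max => /andP[N1m N2m].
have m0 : 0 < m%:R :> R by rewrite ltr0n.
have QmN (k : 'I_d.+1) : eval_log_arctan Q (m + k)%:R != 0.
  by rewrite natrC; apply: QN1; rewrite natrD ltr_wpDr.
have fm (k : 'I_d.+1) : f (m + k)%:R = eval_log_arctan P (m + k)%:R / eval_log_arctan Q (m + k)%:R.
  by have := QmN k; rewrite natrC => Qm; apply: fE => //; rewrite ltr0n addn_gt0.
have fr (k : 'I_d.+1) : f (m + k)%:R = (complex.Re (f (m + k)%:R))%:C.
  apply/esym/RRe_real; rewrite fm rpred_div//.
    rewrite natrD natrC -ev_embed3_shift; exact: ev_shift_real.
  rewrite natrD natrC -ev_embed3_shift; exact: ev_shift_real.
have qf : \sum_k (q k).[m%:R] * complex.Re (f (m + k)%:R) = 0.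
  apply: qrel; rewrite -[RHS](prel m isT); apply: eq_bigr => k _.
  by rewrite -fr -natrC.
have /negP := GN2 _ N2m; apply; apply/eqP.
rewrite rmorph_sum /=.
have evE (k : 'I_d.+1) : ev (m%:R)%:C (shift_fun (m%:R)%:C) (mpolyC _ (q k) *
      (embed3 k P * \prod_(j | j != k) embed3 j Q))
    = (\prod_(j < d.+1) eval_log_arctan Q (m + j)%:R) * ((q k).[m%:R] * complex.Re (f (m + k)%:R))%:C.
  rewrite !rmorphM rmorph_prod /= evC horner_map -fr fm ev_embed3_shift -natrC -natrD.
  have -> : \prod_(j < d.+1 | j != k) ev m%:R (shift_fun m%:R) (embed3 j Q)
      = \prod_(j < d.+1 | j != k) eval_log_arctan Q (m + j)%:R.
    by apply: eq_bigr => j _; rewrite ev_embed3_shift -natrD.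
  rewrite [in RHS](bigD1 k) //=; move: (\prod_(_ < _ | _) _) => X.
  by field; exact: QmN.
under eq_bigr do rewrite evE.
by rewrite -mulr_sumr -rmorph_sum qf rmorph0 mulr0.
Qed.

(** * Extension to the whole open set *)

(** Every ball contains a horizontal segment with y != 0 and s != 0 throughout, hence off both cuts,
    and Q does not vanish identically on it. *)
Lemma eval_log_arctan_neq0_near (R : realType) (Q : {poly {poly {poly R}}}) (z0 : R[i])
    (z : R[i]^o) (A : set R[i]^o) :
    eval_log_arctan Q z0 != 0 -> nbhs z A ->
  exists w : R[i]^o, [/\ A w, cut_plane w & eval_log_arctan Q w != 0].
Proof.
move=> Q0 /nbhs_ballP[e /= e0 eA].
have [eI eR] : complex.Im e = 0 /\ 0 < complex.Re e.
  by move: e0; rewrite ltcE /= => /andP[/eqP ? ?].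
move: {e0} eI eR eA => eI eR eA.
set r := complex.Re e in eR.
have [y [y0 yz]] : exists y : R, y != 0 /\ complex.Im z < y < complex.Im z + r / 2.
  have [h|h] := eqVneq (complex.Im z + r / 4) 0.
    exists (complex.Im z + r / 3); split; last lra.
    by apply/eqP => h'; lra.
  by exists (complex.Im z + r / 4); split => //; lra.
have [b [bz bzr b0]] : exists b, [/\ complex.Re z < b, b <= complex.Re z + r / 2 &
    forall s, complex.Re z < s < b -> s != 0].
  have [h|h] := ltP (complex.Re z) 0.
    exists (Num.min 0 (complex.Re z + r / 2)); split.
    - by rewrite lt_min h /=; lra.
    - by rewrite ge_min lexx orbT.
    - by move=> s; rewrite lt_min => /and3P[_ ? _]; rewrite lt_eqF.
  exists (complex.Re z + r / 2); split=> [||s /andP[? _]]; [lra | lra |].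
  by rewrite gt_eqF// (le_lt_trans h).
have embQ0 : embed3 (ord0 : 'I_1) Q != 0.
  by apply: contraNneq Q0 => eQ; rewrite -[z0]addr0 -(ev_embed3_shift (ord0 : 'I_1)) eQ rmorph0.
have cut s : complex.Re z < s < b -> cut_plane (horizontal y s).
  by move=> /b0 s0; split=> /= -[] /eqP; rewrite ?(negPf y0) ?(negPf s0).
have [|s sab] := @ev_shift_neq0_segment _ _ _ y _ _ embQ0 bz.
  by move=> s sab k; rewrite ord1 addr0; exact: cut.
rewrite ev_embed3_shift addr0 => Qs.
exists (horizontal y s); split => //; last exact: cut.
apply: eA; rewrite -ball_normE /= normc_def ltcE /= eI eqxx /= -/r.
rewrite -[r]ger0_norm ?ltW// -sqrtr_sqr ltr_sqrt; last by rewrite exprn_gt0.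
move: z yz bz bzr sab {b0 cut} => [x0 x1] /= yz bz bzr sab.
(* Both |p| and |q| are below r / 2, so p^2 + q^2 < r^2. *)
set p := x0 - s; set q := x1 - y.
have p2 : 0 < (r / 2 - p) * (r / 2 + p) by apply: mulr_gt0; rewrite /p; lra.
have q2 : 0 < (r / 2 - q) * (r / 2 + q) by apply: mulr_gt0; rewrite /q; lra.
have r2 : 0 < r * r by rewrite mulr_gt0.
by move: p2 q2 r2; move: p q => p q; nra.
Qed.

(** The function a f - b is continuous on U and vanishes at the points of the cut plane in U where Q
    != 0. These are dense in U, so it vanishes on U, including on the cuts. *)
Lemma rational_on_of_relation (R : realType) (U : set R[i]^o) (f : R[i]^o -> R[i]^o)
    (P Q : {poly {poly {poly R}}}) (a b : {poly R[i]}) (z0 : R[i]) :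
    analytic_on U f -> eval_log_arctan Q z0 != 0 ->
    (forall z, U z -> cut_plane z -> eval_log_arctan Q z != 0 ->
      f z = eval_log_arctan P z / eval_log_arctan Q z) ->
    a != 0 -> (forall z, a.[z] * eval_log_arctan P z = b.[z] * eval_log_arctan Q z) ->
  rational_on U f.
Proof.
move=> [oU df] Q0 fE a0 abE; exists b, a; split=> // z Uz az.
suff h : a.[z] * f z - b.[z] = 0.
  by apply: (mulfI az); rewrite mulrCA divff// mulr1; apply/eqP; rewrite -subr_eq0 h.
apply/eqP; apply: contrapT => /negP hz.
have cid : {for z, continuous (id : R[i]^o -> R[i]^o)} by move=> A.
have chorner (p : {poly R[i]}) : {for z, continuous (horner p : R[i]^o -> R[i]^o)}.
  elim/poly_ind: p => [|p c IH].
    have -> : (horner 0 : R[i]^o -> R[i]^o) = fun=> 0 by apply/funext => w; rewrite horner0.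
    exact: (@cst_continuous (R[i]^o) (R[i]^o) 0 z).
  have -> : (horner (p * 'X + c%:P) : R[i]^o -> R[i]^o) = fun w => horner p w * w + c.
    by apply/funext => w; rewrite hornerMXaddC.
  have cX : {for z, continuous (fun w : R[i]^o => (p.[w] * w : R[i]^o))}.
    exact: (@continuousM R[i] (R[i]^o) _ _ z IH cid).
  exact: (@continuousD _ (R[i]^o) (R[i]^o) _ _ z cX (@cst_continuous (R[i]^o) (R[i]^o) c z)).
have cf : {for z, continuous f}.
  by apply: differentiable_continuous; apply/derivable1_diffP; exact: df.
have ch : {for z, continuous (fun w : R[i]^o => a.[w] * f w - b.[w] : R[i]^o)}.
  exact: (@continuousB _ (R[i]^o) (R[i]^o) _ _ z
    (@continuousM R[i] (R[i]^o) _ _ z (chorner a) cf) (chorner b)).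
have Unear : nbhs (z : R[i]^o) U by apply: open_nbhs_nbhs.
have hnear : nbhs (z : R[i]^o) [set w : R[i]^o | a.[w] * f w - b.[w] != 0].
  exact: (@cvgr_neq0 _ (R[i]^o) _ _ _ _ _ ch hz).
have [w [[Uw /eqP hw] cw Qw]] := eval_log_arctan_neq0_near Q0 (filterI Unear hnear).
by apply: hw; rewrite fE// mulrA abE mulfK// subrr.
Qed.

Theorem theorem6 (R : realType) (U : set R[i]^o) (f : R[i]^o -> R[i]^o)
    (hU : positive_reals R `<=` U) (hf : analytic_on U f)
    (hfield : in_field_log_arctan U f) :
  holonomic (fun n : nat => f n%:R) <-> rational_on U f.
Proof.
have [P [Q [[z0 _ Qz0] fE]]] := hfield.
split=> [[d [p [[k pk] prel]]]|].
  have fpos (x : R) : 0 < x -> eval_log_arctan Q x%:C != 0 ->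
      f x%:C = eval_log_arctan P x%:C / eval_log_arctan Q x%:C.
    by move=> x0; apply: fE; [apply: hU; exists x | exact: cut_plane_pos].
  have [a [b [a0 ab]]] := rational_of_holonomic_relation pk Qz0 fpos prel.
  exact: rational_on_of_relation hf Qz0 fE a0 ab.
apply: holonomic_of_rational => n n1; apply: hU; exists n%:R => /=.
  by rewrite ltr0n.
by rewrite rmorph_nat.
Qed.
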